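(* For every integer $m\ge 1$, $$t_{3,2m+1}(m)=\frac{1}{m^2},\qquad t_{3,2m+2}(m)=\left(m-1+t_{3,4}^{-1/2}\right)^{-2}.$$
   Context: An $r$-graph is a pair $H=(V,E)$ with $V$ a finite vertex set and $E$ a set of $r$-element subsets of $V$; connected components are in the usual sense (isolated vertices count as components). For integers $k>r$, an $r$-graph satisfies the covering condition for $k$ if every $k$-element subset of its vertex set contains at least one edge. $T(n,K_k^{(r)})$ is the smallest number of edges of an $n$-vertex $r$-graph satisfying the covering condition for $k$, and $T(n,K_k^{(r)};m)$ is the smallest number of edges of an $n$-vertex $r$-graph with exactly $m$ connected components satisfying the covering condition for $k$. Define $t_{r,k}:=\lim_{n\to\infty}T(n,K_k^{(r)})/\binom{n}{r}$ and $t_{r,k}(m):=\lim_{n\to\infty}T(n,K_k^{(r)};m)/\binom{n}{r}$ (these limits exist). *)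

(* Defs.v *)
From mathcomp Require Import all_boot all_order all_algebra.
From mathcomp Require Import all_classical all_reals all_analysis.

Set Implicit Arguments.
Unset Strict Implicit.
Unset Printing Implicit Defensive.

Import Order.TTheory GRing.Theory Num.Theory.
Import numFieldNormedType.Exports.

Local Open Scope ring_scope.
Local Open Scope classical_set_scope.

Definition rgraph (V : finType) (r : nat) (E : {set {set V}}) : bool :=
  [forall e in E, #|e| == r].

Definition covering (V : finType) (k : nat) (E : {set {set V}}) : bool :=
  [forall K : {set V}, (#|K| == k) ==> [exists e in E, e \subset K]].

Definition adj (V : finType) (E : {set {set V}}) : rel V :=
  fun x y => [exists e in E, (x \in e) && (y \in e)].

(* [n_comp] counts the classes of the reflexive transitive closure of [adj E],
   so that an isolated vertex is a component. *)
Definition ncomponents (V : finType) (E : {set {set V}}) : nat :=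
  n_comp (adj E) predT.

(* T(n, K_k^(r)). An r-graph on n vertices has at most 'C(n, r) edges, so the
   neutral value 'C(n, r) does not affect the minimum, unless no r-graph is
   admissible, in which case it is the value. *)
Definition Tmin (r k n : nat) : nat :=
  \big[minn/'C(n, r)]_(E : {set {set 'I_n}} | rgraph r E && covering k E) #|E|.

(* T(n, K_k^(r); m), with the same convention when no r-graph is admissible;
   for fixed m, r = 3 and k > 2m this happens for finitely many n only. *)
Definition Tmin_comp (r k m n : nat) : nat :=
  \big[minn/'C(n, r)]_(E : {set {set 'I_n}} |
    [&& rgraph r E, ncomponents E == m & covering k E]) #|E|.

Definition Tdensity (R : realType) (r k : nat) : R^nat :=
  fun n => (Tmin r k n)%:R / 'C(n, r)%:R.

Definition Tdensity_comp (R : realType) (r k m : nat) : R^nat :=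
  fun n => (Tmin_comp r k m n)%:R / 'C(n, r)%:R.

Definition tlim (R : realType) (r k : nat) : R := limn (Tdensity R r k).

Definition tlim_comp (R : realType) (r k m : nat) : R :=
  limn (Tdensity_comp R r k m).

(* Main.v *)
(* The independence number of a hypergraph is the sum of the independence
   numbers of its components, so the covering condition for k says that these
   numbers a_i add up to at most k - 1. A component on n_i vertices has at least
   (n_i^3 / w(a_i)^2) / 6 - o(n^3) edges, where w(a) = sqrt(a(a-1)/2) by de Caen's
   bound, except that w(3) = tau := t_{3,4}^(-1/2) by definition of t_{3,4}. By
   convexity the whole graph has at least (n^3 / (sum_i w(a_i))^2) / 6 - o(n^3)
   edges. Since w(a) <= a - 1, and w(a) <= a - 3 + tau for a >= 3 (this uses an
   upper bound on t_{3,4}, obtained from Turan's construction), the sum of the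
   w(a_i) is at most m if k = 2m + 1 and m - 1 + tau if k = 2m + 2. Equality is
   attained by m - 1 complete components and one that is optimal for the
   covering condition for 3, respectively 4. *)

From mathcomp Require Import all_boot ssralg zmodp zify.
Require Import Defs.

Set Implicit Arguments.
Unset Strict Implicit.
Unset Printing Implicit Defensive.

(** * De Caen's bound *)

Definition indep (V : finType) (E : {set {set V}}) (A : {set V}) : bool :=
  [forall e in E, ~~ (e \subset A)].

Definition nindep (V : finType) (E : {set {set V}}) (j : nat) : nat :=
  \sum_(A : {set V} | indep E A && (#|A| == j)) 1.

Definition nfree (V : finType) (E : {set {set V}}) (A : {set V}) : nat :=
  \sum_(v | (v \notin A) && indep E (v |: A)) 1.

Definition nbad (V : finType) (E : {set {set V}}) (A : {set V}) : nat :=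
  \sum_(v | (v \notin A) && ~~ indep E (v |: A)) 1.

Lemma indepPn (V : finType) (E : {set {set V}}) (A : {set V}) :
  reflect (exists2 e, e \in E & e \subset A) (~~ indep E A).
Proof.
rewrite /indep negb_forall_in; apply: (iffP exists_inP) => -[e eE].
  by rewrite negbK; exists e.
by exists e; rewrite ?negbK.
Qed.

Lemma indepS (V : finType) (E : {set {set V}}) (A B : {set V}) :
  A \subset B -> indep E B -> indep E A.
Proof.
move=> AB; apply: contraLR => /indepPn[e eE eA]; apply/indepPn.
by exists e => //; exact: subset_trans eA AB.
Qed.

(** Double counting: pairs (C, u) with [u] outside [C] correspond to pairs (A, w) with [w] in [A],
    through A = C + u and w = u. *)
Lemma sum_setU1 (V : finType) (F : {set V} -> V -> {set V} -> nat) :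
  \sum_(C : {set V}) \sum_(u | u \notin C) F C u (u |: C) =
  \sum_(A : {set V}) \sum_(w in A) F (A :\ w) w A.
Proof.
rewrite !pair_big_dep /=.
rewrite (reindex_onto (fun p : {set V} * V => (p.1 :\ p.2, p.2))
                      (fun p : {set V} * V => (p.2 |: p.1, p.2))) /=; last first.
  by case=> C u /= uC; rewrite setU1K.
apply: eq_big => [[A w]|[A w]] /=.
  rewrite setD11 /=; apply/idP/idP => [/eqP[<-]|wA]; first exact: setU11.
  by rewrite setD1K.
by rewrite setD11 xpair_eqE => /and3P[_ /eqP -> _].
Qed.

Lemma nfree_bad (V : finType) (E : {set {set V}}) (A : {set V}) :
  nfree E A + nbad E A = #|V| - #|A|.
Proof.
rewrite /nfree /nbad -bigID /= sum1_card -(cardsC A) addKn -cardsE.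
by apply: eq_card => x; rewrite !inE.
Qed.

(** An independent (j+1)-set is an extension of each of its j + 1 subsets of size [j], and these are
    all independent. *)
Lemma sum_nfree (V : finType) (E : {set {set V}}) (j : nat) :
  \sum_(C : {set V} | indep E C && (#|C| == j)) nfree E C = j.+1 * nindep E j.+1.
Proof.
pose F (C : {set V}) (u : V) (A : {set V}) : nat := indep E A && (#|A| == j.+1).
transitivity (\sum_(C : {set V}) \sum_(u | u \notin C) F C u (u |: C)).
  rewrite big_mkcond; apply: eq_bigr => C _.
  rewrite -[LHS]/(if _ then \sum_(_ | _) _ else _) big_mkcondr.
  case: ifP => hC.
    apply: eq_bigr => u uC; rewrite /F cardsU1 uC add1n eqSS.
    by case/andP: hC => _ ->; rewrite andbT; case: (indep _ _).
  apply/esym; rewrite big1 // => u uC; rewrite /F cardsU1 uC add1n eqSS.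
  apply/eqP; rewrite eqb0; apply: contraFN hC => /andP[h ->]; rewrite andbT.
  exact: indepS (subsetUr _ _) h.
rewrite sum_setU1 /nindep big_distrr [RHS]big_mkcond; apply: eq_bigr => A _ /=.
rewrite /F sum_nat_const; case: ifP => [/andP[_ /eqP->]|_] //=.
by rewrite muln0.
Qed.

(** An edge that makes [v] bad for [A] contains [v], hence at most two vertices of [A]. Removing any
    of the other vertices of [A], at least j - 1 in number, leaves [v] bad. *)
Lemma nbad_setD1 (V : finType) (E : {set {set V}}) (A : {set V}) (j : nat) :
  rgraph 3 E -> indep E A -> #|A| = j.+1 ->
  j.-1 * nbad E A <= \sum_(w in A) nbad E (A :\ w).
Proof.
move=> /forall_inP hE iA cA.
rewrite /nbad big_distrr /=.
under [X in _ <= X]eq_bigr do rewrite big_mkcond.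
rewrite exchange_big /= big_mkcond leq_sum // => v _; case: ifP => // /andP[vA].
move=> /indepPn[e eE eA]; rewrite muln1.
have ve : v \in e.
  apply: contraLR iA => ve; apply/indepPn; exists e => //.
  apply/subsetP => x xe; have := subsetP eA x xe; rewrite !inE => /orP[/eqP xv|//].
  by rewrite -xv xe in ve.
apply: (@leq_trans (\sum_(w in A :\: e) 1)).
  rewrite sum1_card cardsD cA.
  suff : #|A :&: e| <= 2 by lia.
  have /eqP c3 := hE e eE; rewrite -ltnS -c3; apply: proper_card.
  rewrite properEneq subsetIr andbT; apply: contraNneq vA => h.
  by move: ve; rewrite -h inE => /andP[].
rewrite [X in X <= _]big_mkcond [X in _ <= X]big_mkcond leq_sum // => w _.
rewrite inE; case: ifP => // /andP[we wA]; rewrite wA !inE (negbTE vA) andbF /=.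
suff -> : ~~ indep E (v |: A :\ w) by [].
apply/indepPn; exists e => //; apply/subsetP => x xe; rewrite !inE.
have := subsetP eA x xe; rewrite !inE => /orP[->//|->]; rewrite andbT.
by rewrite (contraNneq _ we) ?orbT // => <-.
Qed.

(** [nbad_setD1] is summed over the independent (j+1)-sets; on the right each [C] occurs once for
    every vertex extending it to such a set. *)
Lemma sum_nbad_succ (V : finType) (E : {set {set V}}) (j : nat) :
  rgraph 3 E ->
  j.-1 * (\sum_(A : {set V} | indep E A && (#|A| == j.+1)) nbad E A) <=
  \sum_(C : {set V} | indep E C && (#|C| == j)) nfree E C * nbad E C.
Proof.
move=> hE.
pose F (C : {set V}) (u : V) (A : {set V}) : nat :=
  (indep E A && (#|A| == j.+1)) * nbad E C.
suff -> : \sum_(C : {set V} | indep E C && (#|C| == j)) nfree E C * nbad E C =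
          \sum_(C : {set V}) \sum_(u | u \notin C) F C u (u |: C).
  rewrite sum_setU1 big_distrr [X in X <= _]big_mkcond leq_sum // => A _ /=.
  case: ifP => // /andP[iA cA]; rewrite /F iA cA.
  under eq_bigr do rewrite mul1n; exact/nbad_setD1/eqP.
rewrite big_mkcond; apply: eq_bigr => C _.
rewrite /F -big_distrl /=; case: ifP => hC.
  congr (_ * _); rewrite /nfree big_mkcondr; apply: eq_bigr => u uC.
  rewrite cardsU1 uC add1n eqSS.
  by case/andP: hC => _ ->; rewrite andbT; case: (indep _ _).
rewrite big1 // => u uC; rewrite cardsU1 uC add1n eqSS.
apply/eqP; rewrite eqb0; apply: contraFN hC => /andP[h ->]; rewrite andbT.
exact: indepS (subsetUr _ _) h.
Qed.

(** Chebyshev's sum inequality: as [f] and [g] have a constant sum, they are oppositely ordered. *)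
Lemma chebyshev_sum (T : finType) (P : pred T) (f g : T -> nat) (K : nat) :
  (forall x, P x -> f x + g x = K) ->
  (\sum_(x | P x) 1) * (\sum_(x | P x) f x * g x) <=
  (\sum_(x | P x) f x) * (\sum_(x | P x) g x).
Proof.
move=> fgK; rewrite -(leq_pmul2l (isT : 0 < 2)).
have dist (a b : T -> nat) : (\sum_(x | P x) a x) * (\sum_(x | P x) b x) =
    \sum_(x | P x) \sum_(y | P y) a x * b y.
  by rewrite big_distrl; apply: eq_bigr => x _; rewrite big_distrr.
(* Both sides are symmetrised in x and y. The terms then compare one by one, because (f x - f y) (g
   x - g y) <= 0. *)
rewrite !mul2n -!addnn !dist [X in X + _ <= _]exchange_big.
rewrite [X in _ <= X + _]exchange_big /= -!big_split /=.
apply: leq_sum => x Px; rewrite -!big_split; apply: leq_sum => y Py /=.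
have := fgK x Px; have := fgK y Py.
have [le|/ltnW le] := leqP (g x) (g y); move: (subnKC le); set d := _ - _ => <-; nia.
Qed.

(** With denominators cleared: from size [j] to size j + 1, the average number of bad vertices grows
    by a factor of at most (j + 1) / (j - 1). Chebyshev's inequality applies since free and bad
    vertices together always number n - j. *)
Lemma nindep_succ_le (V : finType) (E : {set {set V}}) (j : nat) :
  rgraph 3 E ->
  j.-1 * nindep E j *
    (\sum_(A : {set V} | indep E A && (#|A| == j.+1)) nbad E A) <=
  j.+1 * nindep E j.+1 *
    (\sum_(A : {set V} | indep E A && (#|A| == j)) nbad E A).
Proof.
move=> hE; rewrite -sum_nfree; apply: leq_trans (chebyshev_sum (K := #|V| - j) _).
  rewrite mulnAC mulnC leq_mul2l; apply/orP; right; exact: sum_nbad_succ.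
by move=> C /andP[_ /eqP<-]; exact: nfree_bad.
Qed.

Lemma sum_nbad2 (V : finType) (E : {set {set V}}) :
  rgraph 3 E ->
  \sum_(A : {set V} | indep E A && (#|A| == 2)) nbad E A <= 3 * #|E|.
Proof.
move=> /forall_inP hE.
pose F (C : {set V}) (u : V) (A : {set V}) : nat := A \in E.
apply: (@leq_trans (\sum_(C : {set V}) \sum_(u | u \notin C) F C u (u |: C))).
  rewrite big_mkcond leq_sum // => C _; case: ifP => // /andP[_ /eqP cC].
  rewrite /nbad big_mkcondr leq_sum // => u uC; case: ifP => //.
  case/indepPn => e eE eC; rewrite /F; suff <- : e = u |: C by rewrite eE.
  by apply/eqP; rewrite eqEcard eC cardsU1 uC cC (eqP (hE e eE)).
rewrite sum_setU1 -sum1_card big_distrr [X in _ <= X]big_mkcond leq_sum // => A _.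
rewrite /F sum_nat_const; case: ifP => [AE|_]; last by rewrite muln0.
by rewrite (eqP (hE A AE)).
Qed.

Lemma nindep2 (V : finType) (E : {set {set V}}) :
  rgraph 3 E -> nindep E 2 = 'C(#|V|, 2).
Proof.
move=> /forall_inP hE; rewrite -card_draws -sum1_card; apply: eq_bigl => A.
rewrite inE andbC; case: eqP => //= cA; apply/forall_inP => e eE.
by apply/negP => /subset_leq_card; rewrite cA (eqP (hE e eE)).
Qed.

Lemma nindep_gt0P (V : finType) (E : {set {set V}}) (j : nat) :
  reflect (exists2 A : {set V}, indep E A & #|A| = j) (0 < nindep E j).
Proof.
rewrite /nindep sum1_card; apply: (iffP card_gt0P) => -[A].
  by rewrite unfold_in => /andP[iA /eqP]; exists A.
by move=> iA cA; exists A; rewrite unfold_in iA cA eqxx.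
Qed.

Lemma exists_subset_card (V : finType) (A : {set V}) (i : nat) :
  i <= #|A| -> exists2 B : {set V}, B \subset A & #|B| = i.
Proof.
move=> iA; exists [set x in take i (enum A)].
  by apply/subsetP => x; rewrite inE => /mem_take; rewrite mem_enum.
rewrite cardsE (card_uniqP _) ?take_uniq ?enum_uniq // size_takel //.
by rewrite -cardE.
Qed.

Lemma nindep_gt0S (V : finType) (E : {set {set V}}) (i j : nat) :
  i <= j -> 0 < nindep E j -> 0 < nindep E i.
Proof.
move=> ij /nindep_gt0P[A iA cA]; apply/nindep_gt0P.
have [B BA cB] := @exists_subset_card _ A i (leq_trans ij (eq_leq (esym cA))).
by exists B => //; exact: indepS BA iA.
Qed.

(** The factors (i + 1) / (i - 1) for 2 <= i < j + 2 telescope to ['C(j.+2, 2)], and the average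
    over pairs is at most 3 |E| / C(n, 2). *)
Lemma nbad_avg (V : finType) (E : {set {set V}}) (j : nat) :
  rgraph 3 E -> 0 < nindep E j.+2 ->
  (\sum_(A : {set V} | indep E A && (#|A| == j.+2)) nbad E A) * 'C(#|V|, 2) <=
  'C(j.+2, 2) * (3 * #|E|) * nindep E j.+2.
Proof.
move=> hE; elim: j => [|j IH] N_gt0.
  by rewrite nindep2 // binn mul1n leq_mul2r sum_nbad2 ?orbT.
have Nj_gt0 := nindep_gt0S (leqnSn _) N_gt0.
rewrite -(leq_pmul2l (_ : 0 < j.+1 * nindep E j.+2)) ?muln_gt0 //= mulnA.
apply: leq_trans (leq_mul (nindep_succ_le j.+2 hE) (leqnn _)) _.
rewrite -mulnA; apply: leq_trans (leq_mul (leqnn _) (IH Nj_gt0)) _.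
have : j.+3 * 'C(j.+2, 2) = j.+1 * 'C(j.+3, 2).
  by rewrite mul_bin_down subn2.
move/(congr1 (muln^~ (nindep E j.+3 * (3 * #|E|) * nindep E j.+2))) => /=; lia.
Qed.

Lemma covering_indep (V : finType) (E : {set {set V}}) (k : nat) (A : {set V}) :
  covering k E -> indep E A -> #|A| < k.
Proof.
move=> /forallP cE iA; rewrite ltnNge; apply/negP => /exists_subset_card[B BA cB].
have := cE B; rewrite cB eqxx => /exists_inP[e eE eB].
by have /forall_inP/(_ e eE) := iA; rewrite (subset_trans eB BA).
Qed.

(* At the independence number j, every vertex outside an independent j-set is
   bad for it, so that the average number of bad vertices is n - j. *)
Lemma de_caen (V : finType) (E : {set {set V}}) (a : nat) :
  rgraph 3 E -> covering a.+1 E -> 2 <= a ->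
  (#|V| - a) * 'C(#|V|, 2) <= 'C(a, 2) * (3 * #|E|).
Proof.
move=> hE cE a_ge2.
have [n_lt2|n_ge2] := ltnP #|V| 2; first by rewrite bin_small ?muln0.
have N2 : 0 < nindep E 2 by rewrite nindep2 // bin_gt0.
have N_le i : 0 < nindep E i -> i <= a.
  by move=> /nindep_gt0P[A iA <-]; have := covering_indep cE iA.
have [j Nj maxj] := ex_maxnP (ex_intro _ 2 N2) N_le.
have j_ge2 := maxj _ N2; have ja := N_le _ Nj.
have NS0 : nindep E j.+1 = 0.
  by apply/eqP; rewrite -leqn0 leqNgt; apply/negP => /maxj; rewrite ltnn.
have sumB : \sum_(A : {set V} | indep E A && (#|A| == j)) nbad E A =
            (#|V| - j) * nindep E j.
  have sumF := sum_nfree E j; rewrite NS0 muln0 in sumF.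
  transitivity (\sum_(A : {set V} | indep E A && (#|A| == j)) nfree E A +
                \sum_(A : {set V} | indep E A && (#|A| == j)) nbad E A).
    by rewrite sumF.
  rewrite -big_split /= /nindep big_distrr /=; apply: eq_bigr => A /andP[_ /eqP <-].
  by rewrite nfree_bad muln1.
have := @nbad_avg _ E j.-2 hE; rewrite -[j.-2.+2]/(2 + j.-2) -subn2 subnKC // sumB.
move=> /(_ Nj); rewrite mulnAC leq_pmul2r // => h.
(* Passage from the independence number [j] to its bound [a]: n - a <= n - j and C(j, 2) <= C(a,
   2). *)
apply: leq_trans (leq_mul (leq_sub2l _ ja) (leqnn _)) _; apply: leq_trans h _.
by rewrite leq_mul2r leq_bin2l ?orbT.
Qed.

(** * Covering numbers *)

Lemma bigminn_le (I : finType) (P : pred I) (F : I -> nat) (x : nat) (i : I) :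
  P i -> \big[minn/x]_(j | P j) F j <= F i.
Proof.
move=> Pi; have := mem_index_enum i; elim: (index_enum I) => // j s IH.
rewrite inE big_cons => /orP[/eqP<-|/IH h]; first by rewrite Pi geq_minl.
by case: ifP => // _; exact: leq_trans (geq_minr _ _) h.
Qed.

Lemma bigminn_ind (I : finType) (P : pred I) (F : I -> nat) (x : nat)
    (K : nat -> Prop) :
  K x -> (forall i, P i -> K (F i)) -> K (\big[minn/x]_(j | P j) F j).
Proof.
by move=> Kx KF; apply: big_rec => // i y /KF Ki Ky; rewrite /minn; case: ifP.
Qed.

Lemma Tmin_bin (r k n : nat) : Tmin r k n <= 'C(n, r).
Proof.
apply: (@bigminn_ind _ _ _ _ (leq^~ _)) => // E /andP[/forall_inP hE _].
rewrite -[X in _ <= 'C(X, _)]card_ord -card_draws.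
by apply: subset_leq_card; apply/subsetP => e /hE; rewrite inE.
Qed.

(** The neutral value ['C(n, r)] is attained too: it belongs to the complete r-graph, which is
    admissible because r <= k. *)
Lemma Tmin_attained (r k n : nat) : r <= k ->
  exists E : {set {set 'I_n}}, [/\ rgraph r E, covering k E & #|E| = Tmin r k n].
Proof.
move=> rk.
apply: (@bigminn_ind _ _ _ _ (fun v => exists E : {set {set 'I_n}},
          [/\ rgraph r E, covering k E & #|E| = v])) =>
  [|E /andP[hE cE]]; last by exists E.
exists [set e : {set 'I_n} | #|e| == r]; split.
- by apply/forall_inP => e; rewrite inE.
- apply/forallP => K; apply/implyP => /eqP cK.
  have [e eK ce] := @exists_subset_card _ K r (leq_trans rk (eq_leq (esym cK))).
  by apply/exists_inP; exists e; rewrite ?inE ?ce.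
- by rewrite card_draws card_ord.
Qed.

(** The edges inside [S] are pulled back to ['I_#|S|] along the enumeration of [S]. *)
Lemma Tmin_le (V : finType) (E : {set {set V}}) (r k : nat) (S : {set V}) :
  rgraph r E -> (forall K : {set V}, K \subset S -> #|K| = k -> ~~ indep E K) ->
  Tmin r k #|S| <= #|[set e in E | e \subset S]|.
Proof.
move=> /forall_inP hE cE.
pose f : 'I_#|S| -> V := @enum_val _ (mem S).
have fI : injective f := @enum_val_inj _ _.
have fS x : f x \in S := enum_valP x.
pose E' : {set {set 'I_#|S|}} := [set e : {set 'I_#|S|} | f @: e \in E].
apply: (@leq_trans #|E'|).
  apply: bigminn_le; apply/andP; split.
    apply/forall_inP => e; rewrite inE => /hE; by rewrite card_imset.
  apply/forallP => K; apply/implyP => /eqP cK.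
  have /indepPn[e eE eK] : ~~ indep E (f @: K).
    by apply: cE; [apply/subsetP => _ /imsetP[x _ ->] | rewrite card_imset].
  apply/exists_inP; exists (f @^-1: e).
    rewrite inE; suff -> : f @: (f @^-1: e) = e by [].
    apply/setP => y; apply/imsetP/idP => [[x]|ye]; first by rewrite inE => ? ->.
    have /imsetP[x xK yx] := subsetP eK y ye.
    by exists x; rewrite ?inE -?yx.
  apply/subsetP => x; rewrite inE => /(subsetP eK).
  by rewrite mem_imset.
rewrite -(card_imset (mem E') (imset_inj fI)); apply: subset_leq_card.
apply/subsetP => _ /imsetP[e eE ->]; move: eE; rewrite !inE => ->.
by apply/subsetP => _ /imsetP[x _ ->].
Qed.

Lemma Tmin_le_card (V : finType) (E : {set {set V}}) (r k : nat) :
  rgraph r E -> covering k E -> Tmin r k #|V| <= #|E|.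
Proof.
move=> hE /forallP cE; rewrite -cardsT; apply: leq_trans (Tmin_le (k := k) hE _) _.
  move=> K _ cK; have := cE K; rewrite cK eqxx => /exists_inP[e eE eK].
  by apply/indepPn; exists e.
by apply: subset_leq_card; apply/subsetP => e; rewrite inE => /andP[].
Qed.

(** Averaging over vertex deletions: an edge survives the deletion of each of the n + 1 - r vertices
    outside it. *)
Lemma Tmin_succ (r k n : nat) :
  n.+1 * Tmin r k n <= (n.+1 - r) * Tmin r k n.+1.
Proof.
apply: (@bigminn_ind _ _ _ _ (fun v => _ <= _ * v)) => [|E /andP[hE cE]].
  by rewrite -mul_bin_down /= leq_mul2l Tmin_bin orbT.
have le v : Tmin r k n <= #|[set e in E | e \subset ~: [set v]]|.
  have cv : #|~: [set v]| = n by rewrite cardsC1 card_ord.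
  rewrite -[X in Tmin _ _ X]cv.
  apply: Tmin_le => // K _ cK; move/forallP/(_ K): cE.
  by rewrite cK eqxx => /exists_inP[e eE eK]; apply/indepPn; exists e.
apply: (@leq_trans (\sum_(v : 'I_n.+1) #|[set e in E | e \subset ~: [set v]]|)).
  by rewrite -{1}[n.+1]card_ord -sum_nat_const leq_sum.
under eq_bigr do rewrite -sum1_card big_mkcond.
rewrite exchange_big -sum1_card big_distrr /= [X in _ <= X]big_mkcond leq_sum // => e _.
case: ifP => eE; last by rewrite big1 // => v _; rewrite inE eE.
have /forall_inP/(_ e eE)/eqP ce := hE.
rewrite -big_mkcond sum1_card muln1 -ce.
have -> : n.+1 - #|e| = #|~: e| by rewrite [RHS]cardsCs setCK card_ord.
apply/eq_leq/eq_card => v.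
transitivity (e \in [set e0 in E | e0 \subset [set~ v]]) => //.
by rewrite !inE eE subsetC sub1set inE.
Qed.

Lemma leq_imset2_card (aT1 aT2 rT : finType) (f : aT1 -> aT2 -> rT)
    (A : {set aT1}) (B : {set aT2}) :
  #|f @2: (A, B)| <= #|A| * #|B|.
Proof. by rewrite curry_imset2X -cardsX; exact: leq_imset_card. Qed.

Lemma leq_card_bigcup (I T : finType) (P : pred I) (F : I -> {set T}) :
  #|\bigcup_(i | P i) F i| <= \sum_(i | P i) #|F i|.
Proof.
elim/big_rec2: _ => [|i y A _ h]; first by rewrite cards0.
by apply: leq_trans (leq_card_setU _ _) _; rewrite leq_add2l.
Qed.

(* Turan's construction: three classes of size q in cyclic order; the edges are
   the triples inside a class and those with two vertices in a class and one
   in the next class. *)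
Lemma Tmin34_turan (q : nat) :
  Tmin 3 4 (3 * q) <= 3 * ('C(q, 3) + 'C(q, 2) * q).
Proof.
pose S (a : 'I_3) : {set 'I_3 * 'I_q} := [set x | x.1 == a].
have cS a : #|S a| = q.
  have -> : S a = [set (a, j) | j in [set: 'I_q]].
    apply/setP => -[i j]; rewrite inE /=; apply/eqP/imsetP => [->|[j' _ [-> _]] //].
    by exists j; rewrite ?inE.
  by rewrite card_imset ?cardsT ?card_ord // => j j' [].
pose D (a : 'I_3) i : {set {set 'I_3 * 'I_q}} :=
  [set e : {set _} | e \subset S a & #|e| == i].
have cD a i : #|D a i| = 'C(q, i).
  by transitivity 'C(#|S a|, i); [rewrite -cards_draws | rewrite cS].
pose D' a := [set z |: p | z in S (a + 1)%R, p in D a 2].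
pose E := \bigcup_a (D a 3 :|: D' a).
have card3 z a p : z \in S (a + 1)%R -> p \in D a 2 -> #|z |: p| = 3.
  rewrite !inE => /eqP za /andP[pS /eqP cp]; rewrite cardsU1 cp.
  case: (boolP (z \in p)) => //.
  by move=> /(subsetP pS); rewrite inE za; case: a {za pS} => -[|[|[|]]].
have hE : rgraph 3 E.
  apply/forall_inP => e /bigcupP[a _]; rewrite inE => /orP[|].
    by rewrite inE => /andP[].
  by move=> /imset2P[z p zS pD ->]; rewrite (card3 z a p).
have cE : covering 4 E.
  apply/forallP => K; apply/implyP => /eqP cK.
  have sumK : #|K :&: S 0%R| + #|K :&: S 1%R| + #|K :&: S (1 + 1)%R| = 4.
    rewrite -cK -[RHS]sum1_card.
    rewrite (partition_big (fun x : 'I_3 * 'I_q => x.1) predT) //=.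
    rewrite !big_ord_recl big_ord0 addn0 addnA.
    by rewrite -!sum1_card; congr (_ + _ + _); apply: eq_bigl => x; rewrite !inE.
  have three a : 3 <= #|K :&: S a| -> [exists e in E, e \subset K].
    move=> /exists_subset_card[e]; rewrite subsetI => /andP[eK eS] ce.
    apply/exists_inP; exists e => //; apply/bigcupP; exists a => //.
    by rewrite !inE eS ce.
  have two a : 2 <= #|K :&: S a| -> 1 <= #|K :&: S (a + 1)%R| ->
      [exists e in E, e \subset K].
    move=> /exists_subset_card[p]; rewrite subsetI => /andP[pK pS] cp.
    move=> /card_gt0P[z]; rewrite inE => /andP[zK zS].
    apply/exists_inP; exists (z |: p); last by rewrite subUset sub1set zK.
    apply/bigcupP; exists a => //; rewrite inE; apply/orP; right.
    by apply/imset2P; exists z p => //; rewrite inE pS cp /=.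
  (* Four vertices with at most two in each class are split as 2, 2, 0 or 2, 1, 1 in some order.
     Either way, some class with two of them is followed by a class that is met. *)
  have [/three//|h0] := leqP 3 #|K :&: S 0%R|.
  have [/three//|h1] := leqP 3 #|K :&: S 1%R|.
  have [/three//|h2] := leqP 3 #|K :&: S (1 + 1)%R|.
  have t0 := two 0%R; have t1 := two 1%R; have t2 := two (1 + 1)%R.
  have e0 : (1 + 1 + 1)%R = 0%R :> 'I_3 by exact: val_inj.
  rewrite e0 in t2; rewrite GRing.add0r in t0.
  have [[]|[[]|[]]] : (2 <= #|K :&: S 0%R| /\ 1 <= #|K :&: S 1%R|) \/
      (2 <= #|K :&: S 1%R| /\ 1 <= #|K :&: S (1 + 1)%R|) \/
      (2 <= #|K :&: S (1 + 1)%R| /\ 1 <= #|K :&: S 0%R|) by lia.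
  - exact: t0.
  - exact: t1.
  - exact: t2.
have -> : 3 * q = #|{: 'I_3 * 'I_q}| by rewrite card_prod !card_ord.
apply: leq_trans (Tmin_le_card hE cE) _.
apply: leq_trans (leq_card_bigcup _ _) _.
rewrite -[X in X * _](card_ord 3) -sum_nat_const leq_sum // => a _.
apply: leq_trans (leq_card_setU _ _) _; rewrite cD leq_add2l.
by apply: leq_trans (leq_imset2_card _ _ _) _; rewrite cS cD mulnC.
Qed.

(** * Components *)

Lemma sum_card_disjoint (I T : finType) (P : pred I) (F : I -> {set T})
    (U : {set T}) :
  (forall i, P i -> F i \subset U) ->
  (forall i j x, P i -> P j -> x \in F i -> x \in F j -> i = j) ->
  \sum_(i | P i) #|F i| <= #|U|.
Proof.
move=> FU Fdisj; under eq_bigr do rewrite -sum1_card big_mkcond.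
rewrite exchange_big -sum1_card [X in _ <= X]big_mkcond leq_sum // => x _.
rewrite -big_mkcondr /=; case: (pickP [pred i | P i && (x \in F i)]) => [i|h].
  move=> /andP[Pi xF]; rewrite (subsetP (FU i Pi)) // (big_pred1 i) // => j /=.
  by apply/andP/eqP => [[Pj xj]|->//]; exact: Fdisj xF.
by rewrite big_pred0.
Qed.

Lemma adj_sym (V : finType) (E : {set {set V}}) : symmetric (adj E).
Proof. by move=> x y; apply: eq_existsb => e; rewrite [(x \in e) && _]andbC. Qed.

Lemma connect_adj_sym (V : finType) (E : {set {set V}}) : connect_sym (adj E).
Proof. exact/sym_connect_sym/adj_sym. Qed.

Lemma adj_root (V : finType) (E : {set {set V}}) (e : {set V}) (x y : V) :
  e \in E -> x \in e -> y \in e ->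
  fingraph.root (adj E) x = fingraph.root (adj E) y.
Proof.
move=> eE xe ye; apply/eqP; rewrite (root_connect (connect_adj_sym E)).
by apply: connect1; apply/exists_inP; exists e; rewrite ?xe.
Qed.

(** Components are indexed by their canonical roots; the set is empty if [i] is not a root. *)
Definition component (V : finType) (E : {set {set V}}) (i : V) : {set V} :=
  [set x | fingraph.root (adj E) x == i].

Definition max_indep (V : finType) (E : {set {set V}}) (S : {set V}) : {set V} :=
  [arg max_(A > set0 | (A \subset S) && indep E A) #|A|].

Lemma indep_small (V : finType) (E : {set {set V}}) (r : nat) (A : {set V}) :
  rgraph r E -> #|A| < r -> indep E A.
Proof.
move=> /forall_inP hE cA; apply/forall_inP => e eE; apply/negP.
by move=> /subset_leq_card; rewrite (eqP (hE e eE)) leqNgt cA.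
Qed.

(** Edges of size r + 1 are nonempty, so [set0] is independent and the maximum is over a nonempty
    family. *)
Lemma max_indepP (V : finType) (E : {set {set V}}) (r : nat) (S : {set V}) :
  rgraph r.+1 E ->
  [/\ max_indep E S \subset S, indep E (max_indep E S) &
      forall A : {set V}, A \subset S -> indep E A -> #|A| <= #|max_indep E S|].
Proof.
move=> hE; rewrite /max_indep; case: arg_maxnP => /= [|A /andP[AS iA] maxA].
  by rewrite sub0set (indep_small hE) ?cards0.
by split=> // B BS iB; apply: maxA; rewrite BS iB.
Qed.

Lemma Tmin_component (V : finType) (E : {set {set V}}) (S : {set V}) :
  rgraph 3 E ->
  Tmin 3 #|max_indep E S|.+1 #|S| <= #|[set e in E | e \subset S]|.
Proof.
move=> hE; have [_ _ maxA] := max_indepP S hE.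
apply: Tmin_le => // K KS cK; apply/negP => /(maxA K KS).
by rewrite cK ltnn.
Qed.

(** Edges are nonempty, so none lies in two components. *)
Lemma sum_edges_component (V : finType) (E : {set {set V}}) :
  rgraph 3 E ->
  \sum_(i | roots (adj E) i) #|[set e in E | e \subset component E i]| <= #|E|.
Proof.
move=> /forall_inP hE; apply: sum_card_disjoint => [i _|i j e _ _].
  by apply/subsetP => e; rewrite inE => /andP[].
rewrite !inE => /andP[eE ei] /andP[_ ej].
have /card_gt0P[x xe] : 0 < #|e| by rewrite (eqP (hE e eE)).
have := subsetP ei x xe; have := subsetP ej x xe.
by rewrite !inE => /eqP -> /eqP.
Qed.

(** The union of maximum independent sets of the components is independent, because the vertices of
    an edge all lie in one component. *)
Lemma sum_max_indep (V : finType) (E : {set {set V}}) (k : nat) :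
  rgraph 3 E -> covering k E ->
  \sum_(i | roots (adj E) i) #|max_indep E (component E i)| < k.
Proof.
move=> hE cE.
pose A i := max_indep E (component E i).
have AS i : A i \subset component E i by have [] := max_indepP (component E i) hE.
have iA i : indep E (A i) by have [] := max_indepP (component E i) hE.
have inA i x : x \in A i -> fingraph.root (adj E) x = i.
  by move=> /(subsetP (AS i)); rewrite inE => /eqP.
pose U := \bigcup_(i | roots (adj E) i) A i.
apply: (@leq_ltn_trans #|U|).
  apply: (@sum_card_disjoint _ _ _ A) => [i Ri|i j x _ _ /inA <- /inA //].
  exact: bigcup_sup.
apply: covering_indep cE _; apply/forall_inP => e eE; apply/negP => eU.
have /card_gt0P[x xe] : 0 < #|e|.
  by have /forall_inP/(_ e eE)/eqP -> := hE.
have /bigcupP[i _ xi] := subsetP eU x xe.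
have /forall_inP/(_ e eE)/negP := iA i; apply; apply/subsetP => y ye.
have /bigcupP[j _ yj] := subsetP eU y ye.
by rewrite -(inA _ _ xi) (adj_root eE xe ye) (inA _ _ yj).
Qed.

Lemma sum_card_component (V : finType) (E : {set {set V}}) :
  \sum_(i | roots (adj E) i) #|component E i| = #|V|.
Proof.
rewrite -[RHS]sum1_card.
rewrite [RHS](partition_big (fingraph.root (adj E)) (roots (adj E))) /=.
  by apply: eq_bigr => i _; rewrite -sum1_card; apply: eq_bigl => x; rewrite inE.
by move=> x _; exact/roots_root/connect_adj_sym.
Qed.

Lemma max_indep_component_gt0 (V : finType) (E : {set {set V}}) (i : V) :
  rgraph 3 E -> roots (adj E) i -> 0 < #|max_indep E (component E i)|.
Proof.
move=> hE Ri; have [_ _ maxA] := max_indepP (component E i) hE.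
rewrite -(cards1 i) maxA ?sub1set ?inE // (indep_small hE) ?cards1 //.
Qed.

(** Two vertices always form an independent set, so only a single vertex can have independence
    number 1. *)
Lemma card_le_max_indep1 (V : finType) (E : {set {set V}}) (S : {set V}) :
  rgraph 3 E -> #|max_indep E S| <= 1 -> #|S| <= 1.
Proof.
move=> hE A1; have [_ _ maxA] := max_indepP S hE.
rewrite leqNgt; apply/negP => /exists_subset_card[B BS cB].
have := maxA B BS; rewrite (indep_small hE) cB //.
by move=> /(_ isT); move: A1; case: #|_| => [|[]].
Qed.

Lemma card_roots (V : finType) (E : {set {set V}}) :
  \sum_(i | roots (adj E) i) 1 = ncomponents E.
Proof.
by rewrite sum1_card; apply: eq_card => x; rewrite !inE andbT.
Qed.

(** * The construction *)

(** A certificate for the number of components: edges are monochromatic, and every vertex is joined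
    to the representative of its colour. *)
Lemma ncomponents_color (V I : finType) (E : {set {set V}}) (c : V -> I) (v : I -> V) :
  cancel v c -> (forall x y, adj E x y -> c x = c y) ->
  (forall x, connect (adj E) x (v (c x))) -> ncomponents E = #|I|.
Proof.
move=> vK adj_c conn_v.
have conn_c x y : connect (adj E) x y -> c x = c y.
  move=> /connectP[p]; elim: p x => [|z p IH] x /=; first by move=> _ ->.
  by move=> /andP[/adj_c -> /IH].
pose rt := fingraph.root (adj E).
have rtE x y : (rt x == rt y) = (c x == c y).
  rewrite (root_connect (connect_adj_sym E)); apply/idP/eqP => [/conn_c //|cxy].
  apply: connect_trans (conn_v x) _; rewrite cxy connect_adj_sym; exact: conn_v.
rewrite -card_roots sum1_card -(card_imset predT (f := rt \o v)).
  apply: eq_card => x; rewrite unfold_in; apply/idP/imsetP => [/eqP Rx|[i _ ->]].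
    exists (c x) => //=; rewrite -[LHS]Rx; apply/eqP; by rewrite rtE vK.
  exact/roots_root/connect_adj_sym.
by move=> i j /= /eqP; rewrite rtE !vK => /eqP.
Qed.

(** The disjoint union of the sets ['I_(s i)] has [n] elements; the colour is the tag of the x-th
    one. *)
Lemma exists_coloring (I : finType) (s : I -> nat) (n : nat) :
  \sum_i s i = n ->
  exists c : 'I_n -> I, forall i, #|[set x | c x == i]| = s i.
Proof.
move=> sn; pose T := {i : I & 'I_(s i)}.
have sumT (P : pred I) : \sum_(t : T | P (tag t)) 1 = \sum_(i | P i) s i.
  rewrite (eq_bigl (fun t : T => P (tag t) && true)); last by move=> t; rewrite andbT.
  rewrite -(sig_big_dep P (fun i (j : 'I_(s i)) => true) (fun _ _ => 1)) /=.
  by apply: eq_bigr => i _; rewrite sum1_card card_ord.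
have cT : n = #|{: T}| by rewrite -sn -(sumT predT) sum1_card.
pose f (x : 'I_n) : T := enum_val (cast_ord cT x).
have fbij : bijective f.
  exists (fun t : T => cast_ord (esym cT) (enum_rank t)) => [x|t].
    by rewrite /f enum_valK cast_ordK.
  by rewrite /f cast_ordKV enum_rankK.
exists (fun x => tag (f x)) => i.
rewrite -sum1_card (eq_bigl (fun x => tag (f x) == i)); last by move=> x; rewrite inE.
rewrite -(reindex f (onW_bij _ fbij) (P := fun t => tag t == i) (F := fun=> 1)).
by rewrite (sumT (pred1 i)) (big_pred1 i).
Qed.

(** The edges added for connectivity are thus of lower order than n^3. *)
Lemma card_star (V : finType) (v : V) :
  #|[set e : {set V} | (v \in e) && (#|e| == 3)]| <= #|V| ^ 2.
Proof.
pose f (p : V * V) := [set v; p.1; p.2].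
apply: (@leq_trans #|f @: setT|).
  apply: subset_leq_card; apply/subsetP => e; rewrite inE => /andP[ve /eqP ce].
  have /eqP/cards2P[x [y [xy exy]]] : #|e :\ v| = 2.
    by have := cardsD1 v e; rewrite ve ce => -[].
  apply/imsetP; exists (x, y) => //.
  by rewrite /f /= -setUA -exy setD1K.
by apply: leq_trans (leq_imset_card _ _) _; rewrite cardsT card_prod.
Qed.

(* All classes but the first are complete; the first carries an optimal
   K_k-covering graph, to which the star of a vertex is added for connectivity. *)
Lemma Tmin_comp_le (m n k : nat) (c : 'I_n -> 'I_m.+1) :
  3 <= k -> (forall i, 3 <= #|[set x | c x == i]|) ->
  Tmin_comp 3 (2 * m + k) m.+1 n <=
  Tmin 3 k #|[set x | c x == ord0]| + n ^ 2 +
  \sum_(i < m.+1 | i != ord0) 'C(#|[set x | c x == i]|, 3).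
Proof.
move=> k3; pose S i := [set x | c x == i] => S3.
have [v vS] : exists v : 'I_m.+1 -> 'I_n, forall i, v i \in S i.
  have Sn i : exists x, x \in S i.
    by apply/set0Pn; rewrite -card_gt0; apply: leq_trans (S3 i).
  by exists (fun i => xchoose (Sn i)) => i; exact: xchooseP.
have vK : cancel v c by move=> i; have := vS i; rewrite inE => /eqP.
have [G [hG cG eG]] := @Tmin_attained 3 k #|S ord0| k3.
pose f : 'I_#|S ord0| -> 'I_n := @enum_val _ (mem (S ord0)).
have fI : injective f := @enum_val_inj _ _.
have fS x : f x \in S ord0 := enum_valP x.
pose E0 : {set {set 'I_n}} := [set f @: (g : {set _}) | g in G].
pose E1 : {set {set 'I_n}} :=
  [set e : {set 'I_n} | e \subset S ord0 & (v ord0 \in e) && (#|e| == 3)].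
pose E2 : {set {set 'I_n}} :=
  \bigcup_(i : 'I_m.+1 | i != ord0) [set e : {set 'I_n} | e \subset S i & #|e| == 3].
pose E := E0 :|: E1 :|: E2.
have edgeP (e : {set 'I_n}) : e \in E -> #|e| = 3 /\ exists i, e \subset S i.
  rewrite !inE -orbA => /or3P[/imsetP[g gG ->]|/and3P[eS _ /eqP ce]|/bigcupP[i _]].
  - have /forall_inP/(_ g gG)/eqP cg := hG.
    rewrite card_imset //; split=> //; exists ord0.
    by apply/subsetP => _ /imsetP[x _ ->].
  - by split=> //; exists ord0.
  - by rewrite inE => /andP[eS /eqP ce]; split=> //; exists i.
have full i (e : {set 'I_n}) : i != ord0 -> e \subset S i -> #|e| = 3 -> e \in E.
  move=> i0 eS ce; rewrite inE; apply/orP; right; apply/bigcupP.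
  by exists i => //; rewrite inE eS ce.
(* This treats all classes alike in the proof of connectivity. *)
have star i (e : {set 'I_n}) : e \subset S i -> #|e| = 3 -> v i \in e -> e \in E.
  move=> eS ce ve; have [i0|] := eqVneq i ord0; last by move/full; apply.
  by rewrite i0 in eS ve; rewrite !inE eS ve ce orbT.
have hE : rgraph 3 E by apply/forall_inP => e /edgeP[-> _].
apply: (@leq_trans #|E|).
  apply: bigminn_le; apply/and3P; split=> //.
  - rewrite (@ncomponents_color _ _ E c v) ?card_ord //.
      move=> x y /exists_inP[e /edgeP[_ [i eS]] /andP[xe ye]].
      by have := subsetP eS x xe; have := subsetP eS y ye; rewrite !inE => /eqP -> /eqP.
    move=> x; have [->|xv] := eqVneq x (v (c x)); first by rewrite vK.
    have vcx : v (c x) \in S (c x) by [].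
    have xS : x \in S (c x) by rewrite inE.
    (* A third vertex of the class completes [x] and the representative to an edge; this is where
       classes of size at least 3 are needed. *)
    have [z] : exists z, z \in S (c x) :\ x :\ v (c x).
      apply/set0Pn; rewrite -card_gt0; have := S3 (c x).
      rewrite -/(S (c x)) (cardsD1 x) xS (cardsD1 (v (c x)) (S (c x) :\ x)).
      by rewrite in_setD1 eq_sym xv vcx.
    rewrite !inE => /and3P[zv zx zS]; apply: connect1; apply/exists_inP.
    exists [set x; v (c x); z]; last by rewrite !inE !eqxx orbT.
    apply: (@star (c x)); last by rewrite !inE eqxx orbT.
      by rewrite !subUset !sub1set xS vcx inE zS.
    by rewrite -setUA cardsU1 cards2 !inE (negbTE xv)
      [x == z]eq_sym (negbTE zx) [_ == z]eq_sym zv.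
  - apply/forallP => K; apply/implyP => /eqP cK; rewrite -[X in is_true X]negbK.
    apply/negP; rewrite negb_exists_in => iK.
    (* An independent [K] has at most two vertices in each of the [m] complete classes and at most k
       - 1 in the first, hence fewer than 2m + k in all. *)
    have small i : i != ord0 -> #|K :&: S i| <= 2.
      move=> i0; rewrite leqNgt; apply/negP => /exists_subset_card[e].
      rewrite subsetI => /andP[eK eS] /(full i e i0 eS) eE.
      by have /forall_inP/(_ e eE) := iK; rewrite eK.
    have small0 : #|K :&: S ord0| < k.
      rewrite ltnNge; apply/negP => /exists_subset_card[L].
      rewrite subsetI => /andP[LK LS] cL.
      have fL : f @: (f @^-1: L) = L.
        apply/setP => y; apply/imsetP/idP => [[x]|yL]; first by rewrite inE => ? ->.
        have yS := subsetP LS y yL.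
        by exists (enum_rank_in yS y); rewrite ?inE /f enum_rankK_in.
      have /forallP/(_ (f @^-1: L)) := cG.
      rewrite -(card_imset _ fI) fL cL eqxx => /exists_inP[g gG gL].
      have gE : f @: g \in E by rewrite !inE imset_f.
      have /forall_inP/(_ _ gE) := iK; rewrite (subset_trans _ LK) //.
      by rewrite -fL imsetS.
    have : #|K| = \sum_(i < m.+1) #|K :&: S i|.
      rewrite -sum1_card (partition_big c predT) //=; apply: eq_bigr => i _.
      by rewrite -sum1_card; apply: eq_bigl => x; rewrite !inE.
    move=> eK; have : #|K| < k + m * 2.
      rewrite eK big_ord_recl -addSn; apply: leq_add => //.
      rewrite -[X in X * 2]card_ord -sum_nat_const leq_sum // => i _.
      exact: small.
    by rewrite cK mulnC addnC ltnn.
apply: leq_trans (leq_card_setU _ _) _; apply: leq_add.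
  apply: leq_trans (leq_card_setU _ _) _; apply: leq_add.
    by rewrite -eG leq_imset_card.
  rewrite -[X in X ^ 2]card_ord; apply: leq_trans (card_star (v ord0)).
  by apply: subset_leq_card; apply/subsetP => e; rewrite !inE => /andP[].
apply: leq_trans (leq_card_bigcup _ _) _; apply: leq_sum => i _.
by rewrite cards_draws.
Qed.

(** * Densities *)

From mathcomp Require Import all_order all_algebra ring lra.
From mathcomp Require Import all_classical all_reals all_analysis.

Import Order.TTheory GRing.Theory Num.Theory.
Import numFieldNormedType.Exports.

Local Open Scope ring_scope.
Local Open Scope classical_set_scope.

Lemma bin2_natr (R : realType) (n : nat) :
  2 * ('C(n, 2))%:R = n%:R * (n%:R - 1) :> R.
Proof.
elim: n => [|n IH]; first by rewrite bin0n mulr0 mul0r.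
rewrite binS bin1 natrD mulrDr IH -natr1; ring.
Qed.

Lemma bin3_natr (R : realType) (n : nat) :
  6 * ('C(n, 3))%:R = n%:R * (n%:R - 1) * (n%:R - 2) :> R.
Proof.
elim: n => [|n IH]; first by rewrite bin0n mulr0 !mul0r.
have h := bin2_natr R n.
rewrite binS natrD [LHS]mulrDr IH -[n.+1%:R]natr1; lra.
Qed.

Lemma bin3_le (R : realType) (n : nat) : 6 * ('C(n, 3))%:R <= n%:R ^+ 3 :> R.
Proof.
rewrite bin3_natr; case: n => [|n]; first by rewrite !mul0r expr0n.
rewrite -natr1; have : 0 <= n%:R :> R by []; nra.
Qed.

Lemma bin3_ge (R : realType) (n : nat) :
  n%:R ^+ 3 - 3 * n%:R ^+ 2 <= 6 * ('C(n, 3))%:R :> R.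
Proof. rewrite bin3_natr; have : 0 <= n%:R :> R by []; nra. Qed.

Lemma Tdensity_nondecreasing (R : realType) (r k : nat) :
  nondecreasing_seq (Tdensity R r k).
Proof.
apply/nondecreasing_seqP => n; rewrite /Tdensity.
have [rn|nr] := leqP r n; last first.
  by rewrite bin_small // invr0 mulr0 divr_ge0.
rewrite ler_pdivrMr ?ltr0n ?bin_gt0 // mulrAC ler_pdivlMr ?ltr0n ?bin_gt0 ?leqW //.
rewrite -!natrM ler_nat -(leq_pmul2l (_ : 0 < n.+1 - r)%N) ?subn_gt0 ?ltnS //.
have := leq_mul (Tmin_succ r k n) (leqnn 'C(n, r)).
have := mul_bin_down n.+1 r => /=; nia.
Qed.

Lemma Tdensity_le1 (R : realType) (r k n : nat) : Tdensity R r k n <= 1.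
Proof.
rewrite /Tdensity; have [->|C0] := eqVneq 'C(n, r) 0%N.
  by rewrite invr0 mulr0.
by rewrite ler_pdivrMr ?ltr0n ?lt0n // mul1r ler_nat Tmin_bin.
Qed.

Lemma Tdensity_cvg (R : realType) (r k : nat) : cvgn (Tdensity R r k).
Proof.
apply: nondecreasing_is_cvgn; first exact: Tdensity_nondecreasing.
by exists 1 => _ [n _ <-]; exact: Tdensity_le1.
Qed.

Lemma Tdensity_le_tlim (R : realType) (r k n : nat) :
  Tdensity R r k n <= tlim R r k.
Proof.
exact/nondecreasing_cvgn_le/Tdensity_cvg/Tdensity_nondecreasing.
Qed.

Lemma Tmin_le_tlim (R : realType) (r k n : nat) :
  (Tmin r k n)%:R <= tlim R r k * ('C(n, r))%:R.
Proof.
have [C0|C0] := eqVneq 'C(n, r) 0%N.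
  by have := Tmin_bin r k n; rewrite C0 leqn0 => /eqP ->; rewrite mulr0.
by rewrite -ler_pdivrMr ?ltr0n ?lt0n //; exact: Tdensity_le_tlim.
Qed.

Lemma Tmin_ge_tlim (R : realType) (r k : nat) (e : R) : 0 < e ->
  exists N, forall n, (N <= n)%N -> (tlim R r k - e) * ('C(n, r))%:R <= (Tmin r k n)%:R.
Proof.
move=> e_gt0; have /cvgrPdist_le/(_ e e_gt0) := @Tdensity_cvg R r k.
rewrite -/(tlim R r k) => -[N _ h]; exists (maxn N r) => n.
rewrite geq_max => /andP[Nn rn]; rewrite -ler_pdivlMr ?ltr0n ?bin_gt0 //.
have := h n Nn; have := Tdensity_le_tlim R r k n; rewrite /Tdensity => le1.
by rewrite ger0_norm ?subr_ge0 // lerBlDl -lerBlDr.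
Qed.

(** The density of Turan's construction tends to 4/9, which is below 47/100. Since the densities are
    nondecreasing, each is bounded by one at a multiple of 3. *)
Lemma tlim34_le (R : realType) : tlim R 3 4 <= 47 / 100.
Proof.
apply: limr_le; first exact: Tdensity_cvg.
apply: nearW => n; set q := (n + 20)%N.
have le_q : (n <= 3 * q)%N by rewrite /q; lia.
apply: (@le_trans _ _ (Tdensity R 3 4 (3 * q))); first exact: Tdensity_nondecreasing.
have q20 : (20 <= q)%N by rewrite leq_addl.
clearbody q; rewrite /Tdensity ler_pdivrMr ?ltr0n ?bin_gt0; last by lia.
have := Tmin34_turan q; rewrite -(ler_nat R) natrM natrD natrM => le.
have c3 := bin3_natr R q; have c2 := bin2_natr R q.
have := bin3_natr R (3 * q); rewrite natrM => cn.
apply: le_trans le _.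
have c2x : 2 * ('C(q, 2)%:R * q%:R) = q%:R * q%:R * (q%:R - 1) :> R.
  by rewrite mulrA c2; ring.
have : 20 <= q%:R :> R by rewrite ler_nat.
move: (q%:R : R) ('C(q, 2)%:R : R) ('C(q, 3)%:R : R) c3 c2x cn => x y z.
move: ('C(_, 3)%:R : R) => w c3 c2x cn x20.
(* The product is six times the difference of the two sides. *)
have : 0 <= x * (69 / 100 * x ^+ 2 + 531 / 100 * x - 318 / 100).
  by apply: mulr_ge0; [lra | have := sqr_ge0 x; lra].
lra.
Qed.

Lemma Tmin_de_caen (a n : nat) : (2 <= a)%N ->
  ((n - a) * 'C(n, 2) <= 'C(a, 2) * (3 * Tmin 3 a.+1 n))%N.
Proof.
move=> a2; have [E [hE cE <-]] := @Tmin_attained 3 a.+1 n a2.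
by have := de_caen hE cE a2; rewrite card_ord.
Qed.

(** By monotonicity a single [n] suffices: for n = 6, de Caen's bound gives 5 edges out of 20. *)
Lemma tlim34_ge (R : realType) : 1 / 4 <= tlim R 3 4.
Proof.
apply: le_trans (Tdensity_le_tlim R 3 4 6); rewrite /Tdensity.
have h := @Tmin_de_caen 3 6 isT.
move: (Tmin 3 4 6) h => T; have -> : 'C(6, 2) = 15%N by [].
have -> : 'C(6, 3) = 20%N by []; have -> : 'C(3, 2) = 3%N by [].
move=> h; have : (5 <= T)%N by move: h; lia.
rewrite -(ler_nat R); lra.
Qed.

Lemma Tmin_de_caenr (R : realType) (a n : nat) : (2 <= a)%N ->
  n%:R ^+ 3 - a.+1%:R * n%:R ^+ 2 <=
  6 * (Tmin 3 a.+1 n)%:R * (a%:R * (a%:R - 1) / 2) :> R.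
Proof.
move=> a2; have := Tmin_de_caen n a2; set T := Tmin _ _ _ => h.
have T0 : 0 <= T%:R :> R by [].
have a0 : 2 <= a%:R :> R by rewrite ler_nat.
have n0 : 0 <= n%:R :> R by [].
(* For n <= a the subtraction in [Tmin_de_caen] is truncated, but then the left side here is not
   positive. *)
have [na|an] := leqP n a.
  have : n%:R <= a%:R :> R by rewrite ler_nat.
  rewrite -natr1 => na'; apply: (@le_trans _ _ 0); last by rewrite !mulr_ge0 //; lra.
  have : 0 <= n%:R ^+ 2 * (a%:R - n%:R + 1) :> R by rewrite mulr_ge0 ?exprn_ge0 //; lra.
  lra.
move: h; rewrite -(ler_nat R) !natrM natrB; last exact: ltnW.
have := bin2_natr R n; have := bin2_natr R a; rewrite -natr1.
set x := 'C(n, 2)%:R; set y := 'C(a, 2)%:R => ya xn h.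
have : 0 <= a%:R * n%:R :> R by rewrite mulr_ge0 //; lra.
have -> : 6 * T%:R * (a%:R * (a%:R - 1) / 2) = 2 * (y * (3 * T%:R)) by rewrite -ya; field.
have : 2 * ((n%:R - a%:R) * x) = (n%:R - a%:R) * (n%:R * (n%:R - 1)) by rewrite -xn; ring.
lra.
Qed.

(** This is the tangent to x^3 / f^2 at x = l f, multiplied by f^2; its slope 3 l^2 before the
    multiplication does not depend on [f]. *)
Lemma cube_tangent (R : realType) (x f l : R) : 0 <= x -> 0 <= f -> 0 <= l ->
  3 * l ^+ 2 * f ^+ 2 * x - 2 * l ^+ 3 * f ^+ 3 <= x ^+ 3.
Proof.
move=> x0 f0 l0; rewrite -subr_ge0.
have -> : x ^+ 3 - (3 * l ^+ 2 * f ^+ 2 * x - 2 * l ^+ 3 * f ^+ 3) =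
  (x - l * f) ^+ 2 * (x + 2 * (l * f)) by ring.
by rewrite mulr_ge0 ?sqr_ge0 // addr_ge0 // !mulr_ge0.
Qed.

(** * Asymptotic bounds *)

(* tau stands for t_{3,4}^{-1/2}; for a <> 3 the value is the inverse square
   root of de Caen's lower bound for the density t_{3,a+1}. *)
Definition comp_weight (R : realType) (tau : R) (a : nat) : R :=
  if a == 3%N then tau else Num.sqrt (a%:R * (a%:R - 1) / 2).

Lemma sqr_comp_weight (R : realType) (tau : R) (a : nat) : (0 < a)%N -> a != 3%N ->
  comp_weight tau a ^+ 2 = a%:R * (a%:R - 1) / 2.
Proof.
move=> a0 a3; rewrite /comp_weight (negbTE a3) sqr_sqrtr //.
have : 1 <= a%:R :> R by rewrite ler1n.
by move=> a1; rewrite divr_ge0 // mulr_ge0 // subr_ge0.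
Qed.

(** For a other than 3, the squares differ by (a - 1) (a - 2) / 2, which is nonnegative at positive
    integers. *)
Lemma comp_weight_le_predn (R : realType) (tau : R) (a : nat) : tau <= 2 -> (0 < a)%N ->
  comp_weight tau a <= a%:R - 1.
Proof.
move=> tau2 a0; have [->|a3] := eqVneq a 3%N; first by rewrite /comp_weight eqxx; lra.
have a1 : 1 <= a%:R :> R by rewrite ler1n.
rewrite -ler_sqr ?nnegrE ?subr_ge0 //; last by rewrite /comp_weight (negbTE a3) sqrtr_ge0.
rewrite sqr_comp_weight //; case: a a0 a1 {a3} => [//|[|a]] _ a1.
  by rewrite subrr; lra.
have : 2 <= a.+2%:R :> R by rewrite ler_nat.
move: (a.+2%:R : R) => x x2; have : 0 <= (x - 1) * (x - 2) by rewrite mulr_ge0 //; lra.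
lra.
Qed.

(* Any constant from [sqrt 6 - 1, (100 / 47)^(1/2)] would do: the lower end is
   the condition at a = 4, the upper end is allowed by t_{3,4} <= 47 / 100. *)
Lemma comp_weight_le (R : realType) (tau : R) (a : nat) :
  1455 / 1000 <= tau -> (3 <= a)%N ->
  comp_weight tau a <= a%:R - 3 + tau.
Proof.
move=> tau_ge a_ge; have [->|a3] := eqVneq a 3%N; first by rewrite /comp_weight eqxx; lra.
have a4 : 4 <= a%:R :> R by rewrite ler_nat ltn_neqAle eq_sym a3.
rewrite -ler_sqr ?nnegrE; last 2 first.
- by rewrite /comp_weight (negbTE a3) sqrtr_ge0.
- lra.
rewrite sqr_comp_weight ?(leq_trans _ a_ge) //.
apply: (@le_trans _ _ ((a%:R - 3 + 1455 / 1000) ^+ 2)).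
  move: (a%:R : R) a4 => x x4.
  (* Twice the difference of the two sides exceeds this product by a positive constant. *)
  have : 0 <= (x - 4) * (x - 118 / 100) by rewrite mulr_ge0 //; lra.
  lra.
by rewrite ler_sqr ?nnegrE; lra.
Qed.

Lemma sum_comp_weight_le (R : realType) (tau : R) (m : nat) (I : finType) (P : pred I)
    (a : I -> nat) :
  tau <= 2 -> (forall i, P i -> (0 < a i)%N) -> (\sum_(i | P i) 1 = m)%N ->
  \sum_(i | P i) comp_weight tau (a i) <= (\sum_(i | P i) a i)%:R - m%:R.
Proof.
move=> tau2 a0 <-; rewrite !natr_sum -sumrB; apply: ler_sum => i Pi.
exact: comp_weight_le_predn (a0 i Pi).
Qed.

Lemma sum_comp_weight_odd (R : realType) (tau : R) (m : nat) (I : finType) (P : pred I)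
    (a : I -> nat) :
  tau <= 2 -> (forall i, P i -> (0 < a i)%N) -> (\sum_(i | P i) 1 = m)%N ->
  (\sum_(i | P i) a i < 2 * m + 1)%N ->
  \sum_(i | P i) comp_weight tau (a i) <= m%:R.
Proof.
move=> tau2 a0 cP; rewrite addn1 ltnS -(ler_nat R) natrM => le.
apply: le_trans (sum_comp_weight_le tau2 a0 cP) _; lra.
Qed.

(** If the a_i add up to at most 2m, the odd case applies, as tau >= 1. If they add up to 2m + 1,
    some a_i is at least 3; it contributes at most a_i - 3 + tau, and every other a_j at most a_j -
    1. *)
Lemma sum_comp_weight_even (R : realType) (tau : R) (m : nat) (I : finType) (P : pred I)
    (a : I -> nat) :
  1455 / 1000 <= tau -> tau <= 2 ->
  (forall i, P i -> (0 < a i)%N) -> (\sum_(i | P i) 1 = m)%N ->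
  (\sum_(i | P i) a i < 2 * m + 2)%N ->
  \sum_(i | P i) comp_weight tau (a i) <= m%:R - 1 + tau.
Proof.
move=> tau_ge tau2 a0 cP; rewrite addn2 ltnS leq_eqVlt => /orP[/eqP eq|]; last first.
  have := @sum_comp_weight_odd R tau m I P a tau2 a0 cP.
  by rewrite addn1 => h /h; lra.
have [i /andP[Pi ai]] : exists i, P i && (2 < a i)%N.
  apply/existsP; rewrite -[X in is_true X]negbK negb_exists; apply/negP => /forallP h.
  suff : (\sum_(i | P i) a i <= 2 * m)%N by rewrite eq ltnn.
  rewrite -cP big_distrr /=; apply: leq_sum => i Pi.
  by have := h i; rewrite Pi /= -leqNgt.
rewrite (bigD1 i) //= in eq; rewrite (bigD1 i) //= in cP; rewrite (bigD1 i) //=.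
move: eq cP; set s := (\sum_(_ | _) a _)%N; case: m => [|m]; first by rewrite add1n.
move=> eq; rewrite add1n => -[cm].
have := @sum_comp_weight_le R tau m I [pred j | P j && (j != i)] a tau2 _ cm.
move=> /(_ (fun j Pj => a0 j (proj1 (andP Pj)))) /=; rewrite -/s.
have := comp_weight_le tau_ge ai.
have : (a i)%:R + s%:R = 2 * m.+1%:R + 1 :> R by rewrite -natrD eq -natr1 natrM.
rewrite -natr1; lra.
Qed.

(** The edge bound for one component, with its convex main term replaced by a tangent. The error
    depends neither on the size [s] nor on the slope parameter [l], so it can be summed over
    components. *)
Lemma component_lower (R : realType) (tau : R) (M : nat) (e : R) :
  0 < tau -> tlim R 3 4 * tau ^+ 2 = 1 -> 0 < e ->
  exists2 C : R, 0 <= C & forall (a s n b : nat) (l : R),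
    (0 < a <= M)%N -> (s <= n)%N -> 0 <= l <= n%:R -> (a = 1%N -> s <= 1)%N ->
    (Tmin 3 a.+1 s <= b)%N ->
    3 * l ^+ 2 * s%:R - 2 * l ^+ 3 * comp_weight tau a
      - (e * n%:R ^+ 3 + C * n%:R ^+ 2) <= 6 * b%:R.
Proof.
move=> tau0 ttau e0; have [N TN] := @Tmin_ge_tlim R 3 4 e e0.
(* [M] serves the error in de Caen's bound, [N] the components below the threshold of [TN], and 4
   the remaining terms of order n^2. *)
exists (M%:R + N%:R + 4) => [|a s n b l /andP[a0 aM] sn /andP[l0 ln] a1 Tb].
  by rewrite !addr_ge0.
have n0 : 0 <= n%:R :> R by [].
have s0 : 0 <= s%:R :> R by [].
have sn' : s%:R <= n%:R :> R by rewrite ler_nat.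
have Tb' : (Tmin 3 a.+1 s)%:R <= b%:R :> R by rewrite ler_nat.
have b0 : 0 <= b%:R :> R by [].
have e3 : 0 <= e * n%:R ^+ 3 by apply: mulr_ge0; rewrite ?exprn_ge0 // ltW.
have n2 : 0 <= n%:R ^+ 2 :> R by rewrite sqr_ge0.
have Mn : 0 <= M%:R * n%:R ^+ 2 :> R by rewrite mulr_ge0.
have Nn : 0 <= N%:R * n%:R ^+ 2 :> R by rewrite mulr_ge0.
have s2 : s%:R ^+ 2 <= n%:R ^+ 2 :> R by rewrite ler_sqr.
have [a_eq1|a_neq1] := eqVneq a 1%N.
  rewrite a_eq1 /comp_weight /= subrr mulr0 mul0r sqrtr0 mulr0.
  have s1 : s%:R <= 1 :> R by rewrite (ler_nat R s 1) a1.
  have l2 : l ^+ 2 <= n%:R ^+ 2 by rewrite ler_sqr.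
  have : l ^+ 2 * s%:R <= n%:R ^+ 2 * 1 by rewrite ler_pM ?sqr_ge0.
  lra.
have [a_eq3|a_neq3] := eqVneq a 3%N.
  rewrite a_eq3 /comp_weight eqxx; rewrite a_eq3 in Tb'.
  have t_le := tlim34_le R; have t_ge := tlim34_ge R.
  have := cube_tangent s0 (ltW tau0) l0; move: t_le t_ge ttau TN.
  set t := tlim R 3 4 => t_le t_ge ttau TN /(ler_wpM2l (_ : 0 <= t)) h.
  have {h} : 3 * l ^+ 2 * s%:R - 2 * l ^+ 3 * tau <= t * s%:R ^+ 3.
    apply: le_trans (h _); last lra.
    rewrite le_eqVlt; apply/orP; left; apply/eqP.
    have -> : t * (3 * l ^+ 2 * tau ^+ 2 * s%:R - 2 * l ^+ 3 * tau ^+ 3) =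
      (t * tau ^+ 2) * (3 * l ^+ 2 * s%:R - 2 * l ^+ 3 * tau) by ring.
    by rewrite ttau mul1r.
  have [Ns|sN] := leqP N s.
    have := TN s Ns; have := bin3_le R s; have := bin3_ge R s.
    move: ('C(s, 3)%:R : R) => c c_ge c_le Tc.
    have : t * (s%:R ^+ 3 - 3 * s%:R ^+ 2) <= t * (6 * c) by rewrite ler_wpM2l //; lra.
    have : e * (6 * c) <= e * n%:R ^+ 3.
      rewrite ler_wpM2l ?(ltW e0) //; apply: le_trans c_le _.
      by rewrite lerXn2r.
    have : t * s%:R ^+ 2 <= 1 * s%:R ^+ 2 by rewrite ler_wpM2r ?sqr_ge0 //; lra.
    lra.
  (* Below the threshold the cubic term is itself of order n^2. *)
  have : t * s%:R ^+ 3 <= N%:R * n%:R ^+ 2.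
    apply: (@le_trans _ _ (s%:R ^+ 3)).
      by rewrite ler_piMl ?exprn_ge0 //; lra.
    by rewrite exprS ler_pM // ?sqr_ge0 // ler_nat ltnW.
  lra.
have a_ge2 : (2 <= a)%N by rewrite ltn_neqAle eq_sym a_neq1.
have := Tmin_de_caenr R s a_ge2; rewrite -(sqr_comp_weight tau a0 a_neq3).
have w0 : 0 <= comp_weight tau a by rewrite /comp_weight (negbTE a_neq3) sqrtr_ge0.
(* This lets the error (a + 1) s^2 be absorbed after the division by w^2. *)
have w1 : 1 <= comp_weight tau a ^+ 2.
  rewrite sqr_comp_weight //; have : 2 <= a%:R :> R by rewrite ler_nat.
  move: (a%:R : R) => x x2; have : 0 <= (x - 2) * (x + 1) by rewrite mulr_ge0 //; lra.
  lra.
have := cube_tangent s0 w0 l0.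
move: (comp_weight tau a) w0 w1 => w w0 w1 tangent caen.
suff : w ^+ 2 * (3 * l ^+ 2 * s%:R - 2 * l ^+ 3 * w) <=
    w ^+ 2 * ((M%:R + 1) * n%:R ^+ 2 + 6 * b%:R).
  rewrite ler_pM2l; last lra.
  lra.
have : a.+1%:R * s%:R ^+ 2 <= w ^+ 2 * ((M%:R + 1) * n%:R ^+ 2).
  rewrite -[X in X <= _]mul1r ler_pM // ?mulr_ge0 ?sqr_ge0 //.
  by rewrite ler_pM ?sqr_ge0 // natr1 ler_nat.
have : (Tmin 3 a.+1 s)%:R * w ^+ 2 <= b%:R * w ^+ 2 by rewrite ler_wpM2r ?sqr_ge0.
lra.
Qed.

(* The tangent of x^3 / w^2 at l * w, with the common slope l = n / F, turns the
   minimisation over component sizes into a sum. *)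
Lemma Tmin_comp_lower (R : realType) (tau F : R) (k m : nat) :
  0 < tau -> tlim R 3 4 * tau ^+ 2 = 1 -> 1 <= F ->
  (forall (I : finType) (P : pred I) (a : I -> nat),
    (forall i, P i -> (0 < a i)%N) -> (\sum_(i | P i) 1 = m)%N ->
    (\sum_(i | P i) a i < k)%N -> \sum_(i | P i) comp_weight tau (a i) <= F) ->
  forall e : R, 0 < e -> exists2 C : R, 0 <= C & forall n,
    F ^- 2 * n%:R ^+ 3 - e * n%:R ^+ 3 - C * n%:R ^+ 2 <= 6 * (Tmin_comp 3 k m n)%:R.
Proof.
move=> tau0 ttau F1 wF e e0.
have m0 : 0 <= m%:R :> R by [].
(* The errors of [m] components must add up to at most [e]; m + 1 keeps the denominator positive. *)
have e'0 : 0 < e / (m%:R + 1) by rewrite divr_gt0 // ltr_wpDl.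
have [C C0 low] := component_lower k tau0 ttau e'0.
have F0 : 0 < F by rewrite (lt_le_trans _ F1).
have F2 : F ^- 2 <= 1 by rewrite invf_le1 ?exprn_gt0 // exprn_ege1.
(* The summand 3 is for the neutral value of the minimum, by 6 C(n, 3) >= n^3 - 3 n^2. *)
exists (m%:R * C + 3) => [|n]; first by rewrite addr_ge0 // mulr_ge0.
have n0 : 0 <= n%:R :> R by [].
have n2 : 0 <= n%:R ^+ 2 :> R by rewrite sqr_ge0.
have n3 : 0 <= n%:R ^+ 3 :> R by rewrite exprn_ge0.
have mC : 0 <= m%:R * C * n%:R ^+ 2 by rewrite !mulr_ge0.
have en : 0 <= e * n%:R ^+ 3 by rewrite mulr_ge0 // ltW.
apply: (@bigminn_ind _ _ _ _ (fun v => _ <= 6 * v%:R)) => [|E /and3P[hE /eqP mE cE]].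
  have := bin3_ge R n; have : F ^- 2 * n%:R ^+ 3 <= 1 * n%:R ^+ 3 by rewrite ler_wpM2r.
  lra.
pose P := roots (adj E).
pose S i := component E i.
pose a i := #|max_indep E (S i)|.
pose b i := #|[set x in E | x \subset S i]%SET|.
have cm : (\sum_(i | P i) 1 = m)%N by rewrite card_roots.
have sum_a : (\sum_(i | P i) a i < k)%N by exact: sum_max_indep.
have a_gt0 i : P i -> (0 < a i)%N by exact: max_indep_component_gt0.
have sum_b : (\sum_(i | P i) b i <= #|E|)%N by exact: sum_edges_component.
have sum_s : (\sum_(i | P i) #|S i| = n)%N by rewrite sum_card_component card_ord.
have := wF _ P a a_gt0 cm sum_a; set W := \sum_(_ | _) _ => WF.
pose l := n%:R / F.
have l0 : 0 <= l by rewrite divr_ge0 // ltW.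
have ln : l <= n%:R by rewrite ler_pdivrMr // ler_peMr.
pose c := e / (m%:R + 1) * n%:R ^+ 3 + C * n%:R ^+ 2.
have : \sum_(i | P i) (3 * l ^+ 2 * #|S i|%:R -
         2 * l ^+ 3 * comp_weight tau (a i) - c * 1%:R) <=
       \sum_(i | P i) 6 * (b i)%:R.
  apply: ler_sum => i Pi; rewrite mulr1; apply: low.
  - rewrite a_gt0 //=; apply: leq_trans (ltnW sum_a).
    by rewrite (bigD1 i) //= leq_addr.
  - by rewrite -[X in (_ <= X)%N](card_ord n) max_card.
  - by rewrite l0 ln.
  - by move=> a1; apply: card_le_max_indep1 hE _; rewrite -/(a i) a1.
  - exact: Tmin_component.
rewrite !sumrB -!mulr_sumr -!natr_sum -/W cm sum_s => le.
have : 6 * (\sum_(i | P i) b i)%:R <= 6 * #|E|%:R :> R by rewrite ler_wpM2l // ler_nat.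
have : l ^+ 3 * W <= l ^+ 3 * F by rewrite ler_wpM2l // exprn_ge0.
(* Both l^3 F and l^2 n equal n^3 / F^2, so that 3 l^2 n - 2 l^3 W is at least n^3 / F^2. *)
have -> : l ^+ 3 * F = F ^- 2 * n%:R ^+ 3 by rewrite /l; field; rewrite gt_eqF.
have : l ^+ 2 * n%:R = F ^- 2 * n%:R ^+ 3 by rewrite /l; field; rewrite gt_eqF.
have : c * m%:R <= e * n%:R ^+ 3 + m%:R * C * n%:R ^+ 2.
  rewrite mulrDl; apply: lerD; last by rewrite mulrC mulrA.
  have -> : e / (m%:R + 1) * n%:R ^+ 3 * m%:R = (e * n%:R ^+ 3) * (m%:R / (m%:R + 1)).
    by field; rewrite gt_eqF // ltr_wpDl.
  by rewrite ler_piMr // ler_pdivrMr ?ltr_wpDl // mul1r lerDl.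
lra.
Qed.

(** With y = n / F, the complete classes get about y vertices and the first class about f y. The
    main terms t (f y)^3 + m y^3 add up to F y^3 = n^3 / F^2, because t f^2 = 1. *)
Lemma Tmin_comp_upper (R : realType) (m k : nat) (t f : R) : (3 <= k)%N ->
  (forall n, (Tmin 3 k n)%:R <= t * ('C(n, 3))%:R) ->
  0 <= t <= 1 -> t * f ^+ 2 = 1 -> 1 <= f ->
  exists2 C : R, 0 <= C & exists N, forall n, (N <= n)%N ->
    6 * (Tmin_comp 3 (2 * m + k) m.+1 n)%:R <=
    (m%:R + f) ^- 2 * n%:R ^+ 3 + C * n%:R ^+ 2.
Proof.
move=> k3 Tt /andP[t0 t1] tf f1; pose F := m%:R + f.
have m0 : 0 <= m%:R :> R by [].
have F0 : 0 < F by rewrite ltr_wpDl // (lt_le_trans _ f1).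
(* The 6 pays for the n^2 edges of the star; the other terms come from expanding t (f y + m)^3,
   where the [m] is due to rounding. *)
pose C : R := 6 + 3 * m%:R + 3 * f * m%:R ^+ 2 + m%:R ^+ 3.
exists C.
  by rewrite /C !addr_ge0 // ?mulr_ge0 ?exprn_ge0 //; lra.
(* From here on y >= 3, so every class has at least three vertices. *)
exists (Num.truncn (3 * F)).+1 => n nN.
have n_ge : 3 * F <= n%:R.
  by apply: ltW; apply: lt_le_trans (truncnS_gt _) _; rewrite ler_nat.
pose y := n%:R / F; pose q := Num.truncn y.
have y3 : 3 <= y by rewrite ler_pdivlMr.
have y0 : 0 <= y by lra.
have yF : y * F = n%:R by rewrite mulfVK // gt_eqF.
have /andP[qy yq] := truncn_itv y0; rewrite -/q -natr1 in qy yq.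
have q3 : (3 <= q)%N by rewrite truncn_ge_nat.
have mq : m%:R * q%:R <= m%:R * y by rewrite ler_wpM2l.
have mq' : m%:R * (y - 1) <= m%:R * q%:R by rewrite ler_wpM2l //; lra.
have fy : y <= f * y by rewrite ler_peMl.
have qn : (m * q <= n)%N by rewrite -(ler_nat R) natrM -yF /F; lra.
pose n1 := (n - m * q)%N.
have n1E : n1%:R = n%:R - m%:R * q%:R :> R by rewrite natrB // natrM.
have n1_ge : (3 <= n1)%N by rewrite -(ler_nat R) n1E -yF /F; lra.
have n1_le : n1%:R <= f * y + m%:R by rewrite n1E -yF /F; lra.
pose s (i : 'I_m.+1) := if i == ord0 then n1 else q.
have sum_s : (\sum_i s i = n)%N.
  rewrite big_ord_recl /s eqxx /= sum_nat_const card_ord; exact: subnK.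
have [c cs] := exists_coloring sum_s.
have s_ge3 i : (3 <= #|[set x | c x == i]%SET|)%N by rewrite cs /s; case: ifP.
have := Tmin_comp_le k3 s_ge3.
rewrite cs (eq_bigr (fun=> 'C(q, 3))); last by move=> i /negbTE i0; rewrite cs /s i0.
rewrite sum_nat_const (eq_card (B := predC1 ord0)); last by [].
rewrite cardC1 card_ord /= {1}/s eqxx -(ler_nat R) !natrD natrM natrX => le.
have Cq : m%:R * (6 * 'C(q, 3)%:R) <= m%:R * y ^+ 3.
  rewrite ler_wpM2l //; apply: le_trans (bin3_le R q) _.
  by rewrite lerXn2r ?nnegrE.
have Tn1 : 6 * (Tmin 3 k n1)%:R <= t * (f * y + m%:R) ^+ 3.
  apply: (@le_trans _ _ (t * (6 * 'C(n1, 3)%:R))); first by have := Tt n1; lra.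
  rewrite ler_wpM2l //; apply: le_trans (bin3_le R n1) _.
  by rewrite lerXn2r ?nnegrE // addr_ge0 // mulr_ge0 //; lra.
have yn : y <= n%:R by rewrite -yF ler_peMr // /F; lra.
have n1r : 1 <= n%:R :> R by rewrite -yF; lra.
have y2 : y ^+ 2 <= n%:R ^+ 2 by rewrite ler_sqr ?nnegrE.
have yn2 : y <= n%:R ^+ 2 by apply: le_trans yn _; rewrite expr2 ler_peMr.
have n21 : 1 <= n%:R ^+ 2 :> R by rewrite exprn_ege1.
have : t * (f * y + m%:R) ^+ 3 <=
    f * y ^+ 3 + (3 * m%:R + 3 * f * m%:R ^+ 2 + m%:R ^+ 3) * n%:R ^+ 2.
  have -> : t * (f * y + m%:R) ^+ 3 = (t * f ^+ 2) * (f * y ^+ 3 + 3 * m%:R * y ^+ 2) +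
     t * (3 * f * m%:R ^+ 2 * y + m%:R ^+ 3) by ring.
  rewrite tf mul1r.
  have : m%:R * y ^+ 2 <= m%:R * n%:R ^+ 2 by rewrite ler_wpM2l.
  have : t * (3 * f * m%:R ^+ 2 * y + m%:R ^+ 3) <= 3 * f * m%:R ^+ 2 * y + m%:R ^+ 3.
    have fmy : 0 <= f * m%:R ^+ 2 * y.
      exact: mulr_ge0 (mulr_ge0 (le_trans ler01 f1) (sqr_ge0 _)) y0.
    rewrite ler_piMl //; have : 0 <= m%:R ^+ 3 :> R by rewrite exprn_ge0.
    lra.
  have : f * m%:R ^+ 2 * y <= f * m%:R ^+ 2 * n%:R ^+ 2.
    by rewrite ler_wpM2l // mulr_ge0 ?sqr_ge0 //; lra.
  have : m%:R ^+ 3 * 1 <= m%:R ^+ 3 * n%:R ^+ 2 :> R by rewrite ler_wpM2l // exprn_ge0.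
  lra.
have -> : (m%:R + f) ^- 2 * n%:R ^+ 3 = (m%:R + f) * y ^+ 3.
  by rewrite -yF -/F; field; rewrite gt_eqF.
rewrite /C; lra.
Qed.

(** * Passage to the limit *)

Lemma cvg_div_bin3 (R : realType) (u : nat -> nat) (c : R) : 0 <= c ->
  (forall e : R, 0 < e -> exists2 C : R, 0 <= C & forall n,
    c * n%:R ^+ 3 - e * n%:R ^+ 3 - C * n%:R ^+ 2 <= 6 * (u n)%:R) ->
  (exists2 C : R, 0 <= C & exists N, forall n, (N <= n)%N ->
    6 * (u n)%:R <= c * n%:R ^+ 3 + C * n%:R ^+ 2) ->
  (fun n => (u n)%:R / ('C(n, 3))%:R : R) @ \oo --> c.
Proof.
move=> c0 low [C2 C20 [N2 up]]; apply/cvgrPdist_le => e e0.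
have [C1 C10 {}low] := low (e / 2) (divr_gt0 e0 (ltr0Sn _ 1)).
(* The first summand makes C1 n^2 at most (e / 2) n^3 in the lower bound. The second is for the
   upper bound, where 3 (c + e) n^2 is the loss from replacing 6 C(n, 3) by n^3. *)
pose X : R := 2 * C1 / e + (C2 + 3 * (c + e)) / e.
exists (maxn (maxn 3 N2) (Num.truncn X).+1) => // n /=.
rewrite !geq_max => /andP[/andP[n3 N2n] Xn].
have {Xn} Xn : X <= n%:R.
  by apply: ltW; apply: lt_le_trans (truncnS_gt _) _; rewrite ler_nat.
have X1 : 2 * C1 <= e * n%:R.
  rewrite [e * _]mulrC -ler_pdivrMr //; apply: le_trans Xn.
  by rewrite lerDl divr_ge0 ?(ltW e0) //; lra.
have X2 : C2 + 3 * (c + e) <= e * n%:R.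
  rewrite [e * _]mulrC -ler_pdivrMr //; apply: le_trans Xn.
  by rewrite lerDr divr_ge0 ?(ltW e0) // mulr_ge0.
have Cn0 : 0 < 'C(n, 3)%:R :> R by rewrite ltr0n bin_gt0.
have Cle := bin3_le R n; have Cge := bin3_ge R n.
have {}low := low n; have {}up := up n N2n.
have x2 : 0 <= n%:R ^+ 2 :> R by rewrite sqr_ge0.
have x3 : n%:R ^+ 3 = n%:R * n%:R ^+ 2 :> R by rewrite exprS.
rewrite ler_distlC; apply/andP; split.
  (* 6 C(n, 3) <= n^3 can be multiplied by c - e only if that is nonnegative; otherwise the claim is
     trivial. *)
  rewrite ler_pdivlMr //; have [ce|ec] := leP (c - e) 0.
    by apply: (@le_trans _ _ 0) => //; rewrite mulr_le0_ge0 // ltW.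
  have : (c - e) * (6 * 'C(n, 3)%:R) <= (c - e) * n%:R ^+ 3 by rewrite ler_wpM2l // ltW.
  have : 2 * C1 * n%:R ^+ 2 <= e * n%:R * n%:R ^+ 2 by rewrite ler_wpM2r.
  rewrite -mulrA -[in X in _ <= X -> _]mulrA -x3; lra.
rewrite ler_pdivrMr //.
have ce0 : 0 <= c + e by lra.
have := ler_wpM2l ce0 Cge.
have : (C2 + 3 * (c + e)) * n%:R ^+ 2 <= e * n%:R * n%:R ^+ 2 by rewrite ler_wpM2r.
rewrite -[in X in _ <= X -> _]mulrA -x3; lra.
Qed.

(** The range of tau required by the weight estimates: 0.47 * 1.455^2 < 1 and 2^2 / 4 = 1. *)
Lemma inv_sqrt_bounds (R : realType) (t w : R) :
  1 / 4 <= t -> t <= 47 / 100 -> 0 < w -> t * w ^+ 2 = 1 ->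
  1455 / 1000 <= w /\ w <= 2.
Proof.
move=> t_ge t_le w0 tw.
have w2 : 0 <= w ^+ 2 by rewrite sqr_ge0.
split.
  rewrite leNgt; apply/negP => w_lt.
  have : 0 < (1455 / 1000 - w) * (1455 / 1000 + w) by apply: mulr_gt0; lra.
  have : t * w ^+ 2 <= 47 / 100 * w ^+ 2 by rewrite ler_wpM2r.
  lra.
rewrite leNgt; apply/negP => w_gt.
have : 1 / 4 * w ^+ 2 <= t * w ^+ 2 by rewrite ler_wpM2r.
have : 0 < (w - 2) * (w + 2) by apply: mulr_gt0; lra.
lra.
Qed.

(** Convergence is asserted as well, since [limn] returns a default value for a divergent
    sequence. *)
Theorem theorem1p3 (R : realType) (m : nat) (m_ge1 : (1 <= m)%N) :
  [/\ cvgn (Tdensity R 3 4),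
      cvgn (Tdensity_comp R 3 (2 * m + 1) m) &
      cvgn (Tdensity_comp R 3 (2 * m + 2) m)] /\
  (tlim_comp R 3 (2 * m + 1) m = 1 / m%:R ^+ 2 /\
   tlim_comp R 3 (2 * m + 2) m =
     (m%:R - 1 + tlim R 3 4 `^ (- (1 / 2))) ^- 2).
Proof.
set t := tlim R 3 4; set tau := t `^ (- (1 / 2)).
have t_ge : 1 / 4 <= t := tlim34_ge R.
have t_le : t <= 47 / 100 := tlim34_le R.
have t0 : 0 < t by lra.
have tau0 : 0 < tau by rewrite powR_gt0.
have tau2 : tau ^+ 2 = t^-1.
  rewrite -powR_mulrn ?(ltW tau0) // /tau -powRrM.
  by rewrite (_ : - (1 / 2) * 2%:R = -1 :> R) ?powR_inv1 ?(ltW t0) //; field.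
have ttau : t * tau ^+ 2 = 1 by rewrite tau2 mulfV // gt_eqF.
have [tau_ge tau_le] := inv_sqrt_bounds t_ge t_le tau0 ttau.
(* The construction has one distinguished class and [m] complete ones, hence m + 1 components. *)
case: m m_ge1 => // m _.
have m0 : 0 <= m%:R :> R by [].
have cvg_odd : Tdensity_comp R 3 (2 * m.+1 + 1) m.+1 @ \oo --> (m.+1%:R ^- 2 : R).
  apply: cvg_div_bin3; first by rewrite invr_ge0 exprn_ge0.
    apply: (Tmin_comp_lower tau0 ttau); first by rewrite ler1n.
    by move=> I P a; exact: sum_comp_weight_odd.
  (* For odd [k] the first class is complete as well: covering for 3, density 1 and weight 1. *)
  have := @Tmin_comp_upper R m 3 1 1 isT.
  rewrite (_ : 2 * m.+1 + 1 = 2 * m + 3)%N; last first.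
    by rewrite mulnS [(2 + _)%N]addnC -addnA.
  rewrite natr1; apply; rewrite ?lexx ?ler01 ?expr1n ?mulr1 //.
  by move=> n; rewrite mul1r ler_nat Tmin_bin.
have cvg_even : Tdensity_comp R 3 (2 * m.+1 + 2) m.+1 @ \oo -->
    ((m.+1%:R - 1 + tau) ^- 2 : R).
  have mE : m.+1%:R - 1 + tau = m%:R + tau by rewrite -natr1 addrK.
  apply: cvg_div_bin3; first by rewrite invr_ge0 sqr_ge0.
    apply: (Tmin_comp_lower tau0 ttau); first by rewrite mE; lra.
    by move=> I P a; exact: sum_comp_weight_even.
  have := @Tmin_comp_upper R m 4 t tau isT (@Tmin_le_tlim R 3 4).
  rewrite (_ : 2 * m.+1 + 2 = 2 * m + 4)%N; last first.
    by rewrite mulnS [(2 + _)%N]addnC -addnA.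
  rewrite mE; apply => //; last lra.
  by apply/andP; split; lra.
split; first split.
- exact: Tdensity_cvg.
- by apply/cvg_ex; eexists; exact: cvg_odd.
- by apply/cvg_ex; eexists; exact: cvg_even.
split; first by rewrite div1r; apply: cvg_lim.
exact: cvg_lim.
Qed.
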